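(* Let $r\ge 2$ and $d\geq 1$ be integers and let $\mathcal F$ be a nonempty family of connected $r$-uniform hypergraphs. Let $|F|$ denote the number of hyperedges and $V(F)$ the vertex set of $F\in\mathcal F$. Suppose that $m=\max_{F\in\mathcal F}|F|$ (exists and) satisfies $m\ge 2$ and that $a=\min_{F\in\mathcal F}|V(F)|$ satisfies $a\ge r+1$, and put $t=\min\{m,a-1\}$. Then $$\chi_{\mathcal F}^r(d)\le \left\lceil \left(2^{3a-2}\,m^t\,(rd)^m\right)^{\frac{1}{a-2}}\right\rceil .$$
   Context: All hypergraphs are finite. A hypergraph is $r$-uniform if every hyperedge has exactly $r$ vertices; $K_n^r$ is the complete $r$-uniform hypergraph on $n$ vertices; $\Delta(H)$ is the maximum vertex degree of $H$ (the degree of a vertex is the number of hyperedges containing it). A set of vertices is monochromatic under a vertex coloring if all its vertices have the same color; a subhypergraph is bicolored (2-colored) if its vertices receive exactly two colors. For a family $\mathcal F$ of connected hypergraphs, an $\mathcal F$-coloring of a hypergraph $H$ is a coloring of the vertices of $H$ in which no hyperedge is monochromatic and no (not necessarily induced) subhypergraph of $H$ isomorphic to a member of $\mathcal F$ is bicolored. $\chi_{\mathcal F}(H)$ is the minimum number of colors in an $\mathcal F$-coloring of $H$, and $$\chi_{\mathcal F}^r(d):=\max\{\chi_{\mathcal F}(H): H\subset K_n^r \text{ for some } n,\ \Delta(H)=d\},$$ i.e. the maximum is over all $r$-uniform hypergraphs $H$ with maximum degree $d$. *)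

(* Defs.v *)
From mathcomp Require Import all_boot.

Set Implicit Arguments.
Unset Strict Implicit.
Unset Printing Implicit Defensive.

Record hypergraph := Hypergraph {
  vertex :> finType;
  edges : {set {set vertex}} }.

Definition r_uniform (r : nat) (H : hypergraph) : Prop :=
  forall e, e \in edges H -> #|e| = r.

Definition degree (H : hypergraph) (x : H) : nat :=
  #|[set e in edges H | x \in e]|.

Definition max_degree (H : hypergraph) : nat :=
  \max_(x : H) degree x.

Definition adjacent (H : hypergraph) : rel H :=
  fun x y => [exists e in edges H, (x \in e) && (y \in e)].

Definition is_connected (H : hypergraph) : Prop :=
  forall x y : H, connect (@adjacent H) x y.

(* Not necessarily induced: [D] may omit edges of [H] contained in [W]. *)
Definition subhypergraph (H : hypergraph) (W : {set H}) (D : {set {set H}})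
  : Prop :=
  D \subset edges H /\ forall e, e \in D -> e \subset W.

Definition isomorphic_to (F H : hypergraph) (W : {set H}) (D : {set {set H}})
  : Prop :=
  exists f : F -> H,
    [/\ injective f, f @: [set: F] = W
     & [set f @: e | e : {set F} in edges F] = D].

Definition monochromatic (V C : finType) (c : V -> C) (W : {set V}) : Prop :=
  forall x y, x \in W -> y \in W -> c x = c y.

Definition bicolored (V C : finType) (c : V -> C) (W : {set V}) : Prop :=
  #|c @: W| = 2.

(* A family may be infinite, hence a predicate. *)
Definition hfamily := hypergraph -> Prop.

Definition family_coloring (FF : hfamily) (H : hypergraph) (C : finType)
    (c : H -> C) : Prop :=
  (forall e, e \in edges H -> ~ monochromatic c e) /\
  (forall F (W : {set H}) (D : {set {set H}}), FF F ->
     subhypergraph W D -> isomorphic_to F W D -> ~ bicolored c W).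

Definition is_min (P : nat -> Prop) (k : nat) : Prop :=
  P k /\ forall j, P j -> k <= j.

Definition is_max (P : nat -> Prop) (k : nat) : Prop :=
  P k /\ forall j, P j -> j <= k.

Definition is_chi (FF : hfamily) (H : hypergraph) (k : nat) : Prop :=
  is_min (fun j => exists c : H -> 'I_j, family_coloring FF c) k.

(* The second clause also requires the chromatic number of every such [H] to
   exist, so that no [H] is silently dropped from the maximum. *)
Definition is_chi_max (FF : hfamily) (r d k : nat) : Prop :=
  (exists H, [/\ r_uniform r H, max_degree H = d & is_chi FF H k]) /\
  (forall H, r_uniform r H -> max_degree H = d ->
     exists2 j, is_chi FF H j & j <= k).

(* Main.v *)
Require Import Defs.
From mathcomp Require Import all_boot all_order all_algebra.
From mathcomp Require Import zify lra.

(** Let [q] be the ceiling on the right-hand side, so that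
    [q ^ (a - 2) >= 2 ^ (3a - 2) m^t (rd)^m]; every [H] of maximum degree [d]
    has to be coloured with [q] colours.

    Forbidding the bicoloured copies of all members of the family is reduced
    to a bounded number of obstacles at each vertex.  A member [F] is
    connected, so starting at a vertex and adding edges one at a time, each
    meeting the union of the previous ones, gains at least one vertex and one
    edge per step until [F] is exhausted.  After [t = min (m, a - 1)] steps the
    union [W] has at least [a] vertices ([exists_spread_cluster]).  Such
    unions are called clusters; at most [(m r d)^t] of them pass through a
    given vertex of [H] ([cluster_reroot], [card_clusters]), whatever the
    family is.  A bicoloured copy of [F] contains a cluster with at least [a]
    vertices split into two monochromatic parts.  So it is enough to find a
    colouring with no monochromatic edge and no such cluster.

    This is a local lemma, proved by Rosenfeld's counting method
    ([exists_avoiding]).  The claim is that among the colourings of all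
    vertices which avoid the obstacles inside a set [S \ v], at least half
    still avoid those inside [S].  An obstacle at [v] which forces the colours
    on a set [R] once the other colours are known spoils at most
    [q^(-|R|) Q(S \ v \ R)] colourings, where [Q(S)] counts the colourings
    avoiding the obstacles inside [S].  By induction this is at most
    [(2/q)^|R| Q(S \ v)], so the claim follows when the weights [(2/q)^|R|]
    of the obstacles at each vertex sum to at most 1/2.

    A monochromatic edge forces [r - 1] colours, hence the edges at a vertex
    weigh at most [d (2/q)^(r-1)].  A cluster with [w] vertices has [2^w]
    splittings in two parts, each forcing at least [w - 2] colours, hence the
    clusters at a vertex weigh at most [4 (4/q)^(a-2) (mrd)^t].  The choice of
    [q] makes both at most 1/8; for the edges this uses [a <= m(r-1) + 1],
    the largest number of vertices that [m] edges can span connectedly. *)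

Set Implicit Arguments.
Unset Strict Implicit.
Unset Printing Implicit Defensive.

(** * Clusters: connected unions of few edges *)

Lemma card_bigcup_le (T I : finType) (P : pred I) (F : I -> {set T}) :
  (#|\bigcup_(i | P i) F i| <= \sum_(i | P i) #|F i|)%N.
Proof.
elim/big_rec2: _ => [|i n A _ leA]; first by rewrite cards0.
exact: leq_trans (leq_card_setU _ _) (leq_add (leqnn _) leA).
Qed.

Section Clusters.

Variables (V : finType) (E : {set {set V}}).

Definition touching (W : {set V}) : {set {set V}} :=
  [set e in E | ~~ [disjoint e & W]].

(** The unions of [k] successively attached edges, starting from the vertex
    [x].  An edge may be attached although it brings no new vertex, so for
    [k > 0] the unions of fewer edges, but at least one, are included. *)
Fixpoint clusters (k : nat) (x : V) : {set {set V}} :=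
  if k is k'.+1 then
    \bigcup_(W in clusters k' x) [set W :|: e | e in touching W]
  else [set [set x]].

Lemma touchingP (W : {set V}) e :
  reflect (e \in E /\ exists2 z, z \in e & z \in W) (e \in touching W).
Proof.
rewrite inE; apply: (iffP andP) => [[eE /pred0Pn[z /andP[ze zW]]]|].
  by split=> //; exists z.
by case=> eE [z ze zW]; split=> //; apply/pred0Pn; exists z; apply/andP.
Qed.

Lemma clustersSP k x (W : {set V}) :
  reflect (exists W' e, [/\ W' \in clusters k x, e \in touching W'
                          & W = W' :|: e])
          (W \in clusters k.+1 x).
Proof.
apply: (iffP bigcupP) => [[W' W'k /imsetP[e eW' ->]]|[W' [e [W'k eW' ->]]]].
  by exists W', e.
by exists W' => //; apply/imsetP; exists e.
Qed.

Lemma mem_cluster k x (W : {set V}) : W \in clusters k x -> x \in W.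
Proof.
elim: k W => [W /set1P->|k IHk W /clustersSP[W' [e [/IHk xW' _ ->]]]].
  exact: set11.
by rewrite inE xW'.
Qed.

(** Attaching an edge before the first one instead of after the last one
    lets a cluster start at any vertex of that edge. *)
Lemma cluster_prepend k (e : {set V}) y z (W : {set V}) :
  e \in E -> y \in e -> z \in e ->
  W \in clusters k z -> e :|: W \in clusters k.+1 y.
Proof.
move=> eE ye ze; elim: k W => [W /set1P->|k IHk W].
  apply/clustersSP; exists [set y], e; split; first exact: set11.
    by apply/touchingP; split=> //; exists y; rewrite // set11.
  by rewrite setUC (setUidPr _) ?sub1set // (setUidPr _) ?sub1set.
move=> /clustersSP[W' [e' [/IHk W'k /touchingP[e'E [u ue' uW']] ->]]].
apply/clustersSP; exists (e :|: W'), e'; split; rewrite ?setUA //.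
by apply/touchingP; split=> //; exists u; rewrite // inE uW' orbT.
Qed.

(** This makes being a cluster a property of [W] alone, so that the clusters
    through a vertex can be counted as the clusters grown from it. *)
Lemma cluster_reroot k x y (W : {set V}) :
  W \in clusters k x -> y \in W -> W \in clusters k y.
Proof.
elim: k y W => [y W /set1P-> /set1P->|k IHk y W]; first exact: set11.
case/clustersSP=> W' [e [W'k eW' ->]]; have [yW' _|yNW'] := boolP (y \in W').
  by apply/clustersSP; exists W', e; split=> //; apply: IHk.
rewrite inE (negPf yNW') => /= ye; rewrite setUC.
have /touchingP[eE [z ze zW']] := eW'.
exact: cluster_prepend ze (IHk _ _ W'k zW').
Qed.

Lemma card_cluster r k x (W : {set V}) : (forall e, e \in E -> #|e| = r.+1) ->
  W \in clusters k x -> #|W| <= (k * r).+1.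
Proof.
move=> unif; elim: k W => [W /set1P->|k IHk W]; first by rewrite cards1.
case/clustersSP=> W' [e [/IHk leW' /touchingP[/unif er [z ze zW']] ->]].
have := cardsUI W' e; rewrite er.
have : 0 < #|W' :&: e| by apply/card_gt0P; exists z; rewrite inE zW'.
by lia.
Qed.

Lemma card_touching d (W : {set V}) :
  (forall x, #|[set e in E | x \in e]| <= d) -> #|touching W| <= #|W| * d.
Proof.
move=> degE; rewrite -sum_nat_const.
apply: leq_trans (leq_sum _ (fun x _ => degE x)).
apply: leq_trans (card_bigcup_le _ _); apply/subset_leq_card/subsetP => e.
case/touchingP=> eE [z ze zW]; apply/bigcupP; exists z => //.
by rewrite inE eE.
Qed.

(** An edge attached to a cluster [W] contains one of its at most
    [m * r.+1] vertices, each of which lies in at most [d] edges. *)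
Lemma card_clusters r d m k x : (forall e, e \in E -> #|e| = r.+1) ->
  (forall x, #|[set e in E | x \in e]| <= d) -> k <= m ->
  #|clusters k x| <= (m * (r.+1 * d)) ^ k.
Proof.
move=> unif degE; elim: k => [|k IHk] ltkm; first by rewrite cards1.
apply: leq_trans (card_bigcup_le _ _) _; rewrite expnSr.
apply: leq_trans (leq_mul (IHk (ltnW ltkm)) (leqnn _)).
rewrite -sum_nat_const; apply: leq_sum => W Wk.
apply: leq_trans (leq_imset_card _ _) _.
apply: leq_trans (card_touching _ degE) _.
rewrite mulnA leq_mul2r; apply/orP; right.
by apply: leq_trans (card_cluster unif Wk) _; nia.
Qed.

End Clusters.

Lemma clusters_imset (U V : finType) (f : U -> V) (E : {set {set U}})
    (E' : {set {set V}}) k x (W : {set U}) : injective f ->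
  (forall e, e \in E -> f @: e \in E') ->
  W \in clusters E k x -> f @: W \in clusters E' k (f x).
Proof.
move=> f_inj fE; elim: k W => [W /set1P->|k IHk W].
  by rewrite imset_set1 set11.
case/clustersSP=> W' [e [/IHk W'k /touchingP[/fE eE [z ze zW']] ->]].
apply/clustersSP; exists (f @: W'), (f @: e); split; rewrite ?imsetU //.
by apply/touchingP; split=> //; exists (f z); apply: imset_f.
Qed.

Lemma connected_touching (F : hypergraph) (W : {set F}) x : is_connected F ->
  x \in W -> W != [set: F] ->
  exists2 e, e \in touching (edges F) W & ~~ (e \subset W).
Proof.
move=> conF xW WnT; case: (pickP [pred e in touching (edges F) W |
  ~~ (e \subset W)]) => [e /andP[]|none]; first by exists e.
have subW e y z : e \in edges F -> y \in e -> y \in W -> z \in e -> z \in W.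
  move=> eF ye yW ze; have := none e; rewrite inE /=.
  have -> : e \in touching (edges F) W by apply/touchingP; split=> //; exists y.
  by move/negbFE/subsetP; apply.
have clW : closed (@adjacent F) (mem W).
  move=> y z /exists_inP[e eF /andP[ye ze]].
  by apply/idP/idP => ?; [apply: (subW e y z)|apply: (subW e z y)].
case/negP: WnT; apply/eqP/setP => y; rewrite inE.
by rewrite -(closed_connect clW (conF x y)).
Qed.

(** Each step of a greedy growth adds an edge that is not contained in the
    current cluster, so it gains a vertex and an edge; by
    [connected_touching] it can only stop at the whole vertex set.  The strict
    bound on [#|edges F|] holds because a cluster other than the whole set
    leaves an edge out. *)
Lemma exists_spread_cluster (F : hypergraph) k x : is_connected F ->
  1 < #|F| -> exists2 W, W \in clusters (edges F) k x &
    W = [set: F] \/ (k < #|W| /\ k < #|edges F|).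
Proof.
move=> conF F_gt1.
pose inside (W : {set F}) := [set e in edges F | e \subset W].
suff [W Wk WT] : exists2 W, W \in clusters (edges F) k x &
    W = [set: F] \/ (k < #|W| /\ k <= #|inside W|).
  exists W => //; have [->|WnT] := eqVneq W [set: F]; first by left.
  case: WT => [/eqP|[ltkW lekW]]; first by rewrite (negPf WnT).
  right; split=> //; apply: leq_ltn_trans lekW _.
  have [e /touchingP[eF _] eW] := connected_touching conF (mem_cluster Wk) WnT.
  apply/proper_card/properP; split.
    by apply/subsetP => ?; rewrite inE => /andP[].
  by exists e; rewrite // inE (negPf eW) andbF.
have x1nT : [set x] != [set: F].
  by apply: contraTneq F_gt1 => FT; rewrite -cardsT -FT cards1.
elim: k => [|k [W Wk WT]].
  by exists [set x]; [exact: set11|right; rewrite cards1].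
have [WE|WnT] := eqVneq W [set: F].
  have [e /touchingP[eF [z ze _]] _] := connected_touching conF (set11 x) x1nT.
  exists [set: F]; last by left.
  apply/clustersSP; exists W, e; rewrite WE setTU -{1}WE; split=> //.
  by apply/touchingP; split=> //; exists z.
case: WT => [/eqP|[ltkW lekW]]; first by rewrite (negPf WnT).
have [e eW eNW] := connected_touching conF (mem_cluster Wk) WnT.
exists (W :|: e); first by apply/clustersSP; exists W, e.
right; split.
  apply: leq_ltn_trans ltkW _; apply/proper_card.
  by rewrite properE subsetUl subUset subxx.
apply: leq_ltn_trans lekW _; apply/proper_card/properP; split.
  apply/subsetP => f; rewrite !inE => /andP[-> fW].
  exact: subset_trans fW (subsetUl _ _).
have [eF _] := touchingP _ _ _ eW.
by exists e; rewrite inE eF ?subsetUr // (negPf eNW).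
Qed.

(** * The counting local lemma *)

Import Order.TTheory GRing.Theory Num.Theory.
Local Open Scope ring_scope.

Section Counting.

Variables (K : realFieldType) (V C I : finType).

(** The pairs of a colouring of [X] and of arbitrary colours on [T] inject
    into [Y]: recolouring [T] loses nothing, since the colours outside [T]
    determine the colouring of [X]. *)
Lemma card_resample (X Y : {set {ffun V -> C}}) (T : {set V}) :
  (forall c c' : {ffun V -> C}, c \in X -> c' \in X ->
     {in ~: T, c =1 c'} -> c = c') ->
  (forall c c' : {ffun V -> C}, c \in X -> {in ~: T, c =1 c'} -> c' \in Y) ->
  (#|C| ^ #|T| * #|X| <= #|Y|)%N.
Proof.
move=> detX XY.
have [->|[c0 _]] := set_0Vmem X; first by rewrite cards0 muln0.
have [->|[v _]] := set_0Vmem T; first last.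
  (* A recolouring of T is a function equal to the dummy colour y off T. *)
  pose y := c0 v.
  pose h (p : {ffun V -> C} * {ffun V -> C}) :=
    [ffun x => if x \in T then p.2 x else p.1 x].
  pose G := [set g in pffun_on y (mem T) predT].
  have cardG : #|G| = (#|C| ^ #|T|)%N by rewrite cardsE card_pffun_on.
  rewrite -cardG mulnC -cardsX.
  have hinj : {in setX X G &, injective h}.
    move=> [c g] [c' g']; rewrite !inE /= => /andP[cX gG] /andP[c'X g'G] hE.
    have cE : c = c'.
      apply: detX => // x; rewrite inE => /negPf xT.
      by have /ffunP/(_ x) := hE; rewrite !ffunE xT.
    congr pair => //; apply/ffunP => x.
    have [xT|/negPf xT] := boolP (x \in T).
      by have /ffunP/(_ x) := hE; rewrite !ffunE /= xT.
    have off (f : {ffun V -> C}) : f \in pffun_on y (mem T) predT -> f x = y.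
      by case/pffun_onP => /supportP/(_ x) fT _; apply: fT; apply: negbT.
    by rewrite !off.
  rewrite -(card_in_imset hinj); apply: subset_leq_card.
  apply/subsetP => _ /imsetP[[c g] + ->]; rewrite in_setX => /andP[cX _].
  apply: (XY c) => // x; rewrite inE => /negPf xT.
  by rewrite ffunE xT.
rewrite cards0 expn0 mul1n; apply/subset_leq_card/subsetP => c cX.
exact: (XY c).
Qed.

(** The event [B i] only depends on the colours in [D i], and when it holds the
    colours in [R i] are forced by the other ones.  [D i] must not be empty: a
    constant event is charged to no vertex in [sum_le]. *)
Variables (D R : I -> {set V}) (B : I -> pred {ffun V -> C}) (P : pred I).
Hypothesis D_neq0 : forall i, P i -> D i != set0.
Hypothesis B_local :
  forall i (c c' : {ffun V -> C}), P i -> {in D i, c =1 c'} -> B i c -> B i c'.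
Hypothesis B_determined :
  forall i (c c' : {ffun V -> C}), P i ->
  B i c -> B i c' -> {in ~: R i, c =1 c'} -> c = c'.
Hypothesis sum_le : forall v,
  \sum_(i | P i && (v \in D i)) (2 / #|C|%:R) ^+ #|R i| <= 1 / 2 :> K.
Hypothesis C_gt0 : (0 < #|C|)%N.

(** Total colourings are counted even though only the vertices of [S] matter:
    the others are free, and counts for different [S] become comparable. *)
Definition avoiding (S : {set V}) : {set {ffun V -> C}} :=
  [set c | [forall i, (P i && (D i \subset S)) ==> ~~ B i c]].

Lemma avoidingP (S : {set V}) c :
  reflect (forall i, P i -> D i \subset S -> ~~ B i c) (c \in avoiding S).
Proof.
rewrite inE; apply: (iffP forallP) => h i.
  by move=> Pi DS; have /implyP := h i; apply; rewrite Pi.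
by apply/implyP => /andP[]; apply: h.
Qed.

(** Recolouring [R i] cannot create an obstacle inside [S] that avoids [R i]. *)
Lemma card_avoiding_event i (S : {set V}) : P i ->
  (#|C| ^ #|R i| * #|[set c in avoiding S | B i c]| <=
   #|avoiding (S :\: R i)|)%N.
Proof.
move=> Pi; apply: card_resample => [c c'|c c'].
  by rewrite !inE => /andP[_ Bc] /andP[_ Bc']; apply: (B_determined Pi).
rewrite inE => /andP[/avoidingP cS _] ccR; apply/avoidingP => j Pj DS.
apply/negP => Bc'; have /negP[] : ~~ B j c.
  by apply: cS => //; apply: subset_trans DS (subsetDl _ _).
apply: (B_local Pj _ Bc') => x /(subsetP DS); rewrite inE => /andP[xR _].
by rewrite ccR // inE.
Qed.

(** Rosenfeld's induction on [S].  The obstacles that become relevant with [v]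
    are those with [v] in [D i]; by [card_avoiding_event] and the induction
    hypothesis applied once for each vertex of [R i], the obstacle [i] spoils
    at most a fraction [(2 / #|C|) ^+ #|R i|] of the colourings. *)
Lemma avoiding_half (S : {set V}) v :
  v \in S -> (#|avoiding (S :\ v)| <= 2 * #|avoiding S|)%N.
Proof.
have [n] := ubnP #|S|; elim: n => // n IHn in S v *.
rewrite ltnS => leSn vS; set S' := S :\ v.
have ltS' : (#|S'| < n)%N.
  by apply: leq_trans leSn; rewrite [#|S|](cardsD1 v) vS.
(* The induction hypothesis, used for the vertices of T one at a time. *)
have peel (T : {set V}) :
    (#|avoiding (S' :\: T)| <= 2 ^ #|T| * #|avoiding S'|)%N.
  elim: {T}_.+1 {-2}T (ltnSn #|T|) => // k IHk T.
  have [->|[x xT]] := set_0Vmem T; first by rewrite setD0 cards0 mul1n.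
  rewrite (cardsD1 x) xT ltnS add1n => ltk.
  have /(leq_trans _) := leq_mul (leqnn 2) (IHk _ ltk).
  rewrite mulnA -expnS; apply.
  have -> : S' :\: T = (S' :\: (T :\ x)) :\ x.
    by apply/setP => y; rewrite !inE; case: (eqVneq y x) => [->|]; rewrite ?xT.
  have [xS|xS] := boolP (x \in S' :\: (T :\ x)).
    apply: IHn xS; apply: leq_ltn_trans ltS'.
    exact/subset_leq_card/subsetDl.
  rewrite (setDidPl _) ?leq_pmull // disjoint_sym.
  by rewrite disjoints1.
have q_gt0 : 0 < #|C|%:R :> K by rewrite ltr0n.
pose Bad i := [set c in avoiding S' | B i c].
have cover_bad : (#|avoiding S'| <=
    #|avoiding S| + \sum_(i | P i && (v \in D i)) #|Bad i|)%N.
  apply: leq_trans (leq_add (leqnn _) (card_bigcup_le _ _)).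
  apply: leq_trans (leq_card_setU _ _).
  apply/subset_leq_card/subsetP => c cS'; rewrite inE orbC -implyNb.
  apply/implyP => nbad; apply/avoidingP => i Pi DS.
  have [vD|vD] := boolP (v \in D i); last first.
    by have /avoidingP h := cS'; apply: h => //; rewrite subsetD1 DS vD.
  apply: contra nbad => Bc; apply/bigcupP; exists i; first by rewrite Pi.
  by rewrite inE cS'.
have bad i : P i -> #|Bad i|%:R <=
    (2 / #|C|%:R) ^+ #|R i| * #|avoiding S'|%:R :> K.
  move=> Pi; rewrite expr_div_n mulrAC ler_pdivlMr ?exprn_gt0 // mulrC.
  rewrite -!natrX -!natrM ler_nat.
  exact: leq_trans (card_avoiding_event S' Pi) (peel _).
have : \sum_(i | P i && (v \in D i)) #|Bad i|%:R <=
    1 / 2 * #|avoiding S'|%:R :> K.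
  apply: le_trans (ler_wpM2r (ler0n _ _) (sum_le v)).
  by rewrite mulr_suml; apply: ler_sum => i /andP[Pi _]; apply: bad.
move: cover_bad; rewrite -(ler_nat K) natrD natr_sum -(ler_nat K) natrM.
by lra.
Qed.

(** For the empty set every colouring is avoiding, and adding a vertex to [S]
    costs at most a factor 2. *)
Theorem exists_avoiding : exists c, forall i, P i -> ~~ B i c.
Proof.
have pos (S : {set V}) : (0 < #|avoiding S|)%N.
  elim: {S}_.+1 {-2}S (ltnSn #|S|) => // n IHn S.
  have [->|[v vS]] := set_0Vmem S => [_|].
    have /card_gt0P[x _] := C_gt0.
    apply/card_gt0P; exists [ffun=> x]; apply/avoidingP => i Pi.
    by rewrite subset0 (negPf (D_neq0 Pi)).
  rewrite (cardsD1 v) vS ltnS => /IHn; rewrite lt0n => S'_gt0.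
  have := avoiding_half vS; case: #|avoiding S| => // /[!muln0].
  by rewrite leqn0 (negPf S'_gt0).
have /card_gt0P[c /avoidingP cP] := pos [set: V].
by exists c => i Pi; apply: cP.
Qed.

End Counting.

(** * Monochromatic edges and two-coloured clusters *)

Section Obstacles.

Variables (V C : finType).

Definition monob (c : {ffun V -> C}) (A : {set V}) :=
  [forall x in A, forall y in A, c x == c y].

Lemma monobP (c : {ffun V -> C}) (A : {set V}) :
  reflect {in A &, forall x y, c x = c y} (monob c A).
Proof.
apply: (iffP forall_inP) => [h x y xA yA|h x xA].
  by apply/eqP; apply: (forall_inP (h x xA)).
by apply/forall_inP => y yA; apply/eqP/h.
Qed.

(** The part of [A] that is recoloured: when [A] is monochromatic, the vertex
    left out forces the colours of all the others. *)
Definition all_but_one (A : {set V}) : {set V} :=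
  if [pick x in A] is Some x then A :\ x else set0.

Lemma all_but_one_sub A : all_but_one A \subset A.
Proof.
by rewrite /all_but_one; case: pickP => [x _|]; rewrite ?subsetDl ?sub0set.
Qed.

Lemma card_all_but_one A : #|all_but_one A| = #|A|.-1.
Proof.
rewrite /all_but_one; case: pickP => [x xA|A0].
  by rewrite [#|A|](cardsD1 x) xA.
by rewrite (eq_card0 A0) cards0.
Qed.

Lemma monob_local (c c' : {ffun V -> C}) (A : {set V}) :
  {in A, c =1 c'} -> monob c A -> monob c' A.
Proof.
by move=> cc /monobP cA; apply/monobP => x y xA yA; rewrite -!cc //; apply: cA.
Qed.

Lemma monob_determined (c c' : {ffun V -> C}) (A : {set V}) :
  monob c A -> monob c' A ->
  {in A :\: all_but_one A, c =1 c'} -> {in A, c =1 c'}.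
Proof.
move=> /monobP cA /monobP c'A cc x xA.
have [z zA zR] : exists2 z, z \in A & z \notin all_but_one A.
  rewrite /all_but_one; case: pickP => [z zA|A0].
    by exists z; rewrite ?setD11.
  by have := A0 x; rewrite /= xA.
by rewrite (cA x z) // (c'A x z) // cc // inE zR.
Qed.

End Obstacles.

(** The bound on [q ^ (a - 2)] has to be turned into one on [q ^ (r - 1)].
    Raising it to the power [r - 1] gives a factor [(r d) ^ (m (r - 1))], and
    [a - 2 <= m (r - 1)]. *)
Lemma expn_bounds r d m a t q :
  (1 < r -> 0 < d -> 1 < m -> 2 < a -> a <= (m * r.-1).+1 -> t <= m ->
  2 ^ (3 * a - 2) * m ^ t * (r * d) ^ m <= q ^ (a - 2) ->
  [/\ 8 <= q, 8 ^ r.-1 * (r * d) <= q ^ r.-1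
    & 2 ^ (3 * a - 2) * (m * (r * d)) ^ t <= q ^ (a - 2)])%N.
Proof.
move=> r_gt1 d_gt0 m_gt1 a_gt2 le_a letm le_q.
have rd_gt0 : (0 < r * d)%N by rewrite muln_gt0 d_gt0 ltnW.
have m_gt0 := ltnW m_gt1; have a2_gt0 : (0 < a - 2)%N by rewrite subn_gt0.
have le8 : (8 ^ (a - 2) <= 2 ^ (3 * a - 2))%N.
  by rewrite -[8%N]/(2 ^ 3)%N -expnM leq_pexp2l //; lia.
have le1 : (8 ^ (a - 2) * (r * d) ^ m <= q ^ (a - 2))%N.
  apply: leq_trans le_q; rewrite leq_mul // -[leqLHS]muln1 leq_mul //.
  by rewrite expn_gt0 m_gt0.
split.
- rewrite -(leq_exp2r _ _ a2_gt0); apply: leq_trans le1.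
  by rewrite leq_pmulr // expn_gt0 rd_gt0.
- rewrite -(leq_exp2r _ _ a2_gt0) (expnAC q).
  have r1_gt0 : (0 < r.-1)%N by lia.
  have := le1; rewrite -(leq_exp2r _ _ r1_gt0); apply: leq_trans.
  rewrite !(expnMn (8 ^ _)) (expnAC 8) leq_mul // -expnM.
  by rewrite leq_pexp2l //; lia.
- apply: leq_trans le_q; rewrite expnMn mulnA leq_mul //.
  by rewrite leq_pexp2l.
Qed.

Lemma edge_weight (K : realFieldType) (V : finType) (E : {set {set V}})
    r d q v :
  (forall e, e \in E -> #|e| = r.+1) -> (#|[set e in E | v \in e]| <= d)%N ->
  (0 < q)%N -> (8 * 2 ^ r * d <= q ^ r)%N ->
  \sum_(e | (e \in E) && (v \in e)) (2 / q%:R) ^+ #|all_but_one e|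
    <= 1 / 8 :> K.
Proof.
move=> unif deg q_gt0 le_q.
rewrite (eq_bigr (fun=> (2 / q%:R) ^+ r)); last first.
  by move=> e /andP[eE _]; rewrite card_all_but_one unif.
rewrite (eq_bigl (mem [set e in E | v \in e])) => [|e]; last by rewrite !inE.
rewrite sumr_const -[leLHS]mulr_natr expr_div_n mulrAC.
have qr_gt0 : 0 < q%:R ^+ r :> K by rewrite exprn_gt0 ?ltr0n.
rewrite ler_pdivrMr //.
have : (8 * (2 ^ r * #|[set e in E | v \in e]|))%:R <= (q ^ r)%:R :> K.
  by rewrite ler_nat; apply: leq_trans le_q; rewrite mulnA leq_mul.
by rewrite natrM natrX natrM natrX; lra.
Qed.

(** A cluster [W] with [w >= a + 2] vertices has [2 ^ w] subsets [A], and the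
    splitting in [A] and [W :\: A] forces at least [w - 2] colours.  Since
    [2 ^ w (2 / q) ^ (w - 2) = 4 (4 / q) ^ (w - 2)] does not increase with
    [w] when [q >= 4], the worst case is [w = a + 2]. *)
Lemma cluster_weight (K : realFieldType) (V : finType) (CC : {set {set V}})
    a T q v :
  (forall W, W \in CC -> a.+2 <= #|W|)%N ->
  (#|[set W in CC | v \in W]| <= T)%N ->
  (4 <= q)%N -> (32 * 4 ^ a * T <= q ^ a)%N ->
  \sum_(p : {set V} * {set V} |
      (p.1 \in CC) && (p.2 \subset p.1) && (v \in p.1))
    (2 / q%:R) ^+ #|all_but_one p.2 :|: all_but_one (p.1 :\: p.2)|
    <= 1 / 8 :> K.
Proof.
move=> CC_ge leT q_ge4 le_q.
have q_gt0 : 0 < q%:R :> K by rewrite ltr0n (leq_trans _ q_ge4).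
have q_ge4' : 4 <= q%:R :> K by rewrite ler_nat.
have x_ge0 : 0 <= 2 / q%:R :> K by rewrite divr_ge0 // ltW.
have x_le1 : 2 / q%:R <= 1 :> K by rewrite ler_pdivrMr //; lra.
have y_le1 : 4 / q%:R <= 1 :> K by rewrite ler_pdivrMr //; lra.
apply: le_trans (_ : \sum_(p : {set V} * {set V} |
      (p.1 \in [set W in CC | v \in W]) && (p.2 \in powerset p.1))
    (2 / q%:R) ^+ (#|p.1| - 2) <= _).
  rewrite [leRHS](eq_bigl (fun p : {set V} * {set V} =>
    (p.1 \in CC) && (p.2 \subset p.1) && (v \in p.1))) => [|p].
    2: by rewrite !inE andbAC.
  apply: ler_sum => -[W A] /= /andP[/andP[_ AW] _].
  apply: ler_wiXn2l => //.
  rewrite cardsU (_ : _ :&: _ = set0) ?cards0 ?subn0 ?card_all_but_one.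
    by rewrite cardsD (setIidPr AW); have := subset_leq_card AW; lia.
  apply/setP => x; rewrite !inE; apply: contraTF isT => /andP[].
  move=> /(subsetP (all_but_one_sub _)) xA /(subsetP (all_but_one_sub _)).
  by rewrite inE xA.
rewrite -(pair_big_dep (fun W => W \in [set W in CC | v \in W])
  (fun W A => A \in powerset W) (fun W _ => (2 / q%:R) ^+ (#|W| - 2))) /=.
apply: le_trans (_ : \sum_(W in [set W in CC | v \in W])
    4 * (4 / q%:R) ^+ a <= _).
  apply: ler_sum => W; rewrite inE => /andP[/CC_ge aW _].
  rewrite sumr_const card_powerset -[leLHS]mulr_natr natrX.
  have W_ge2 : (2 <= #|W|)%N by apply: leq_trans aW.
  rewrite -[X in _ * 2 ^+ X](subnK W_ge2) exprD mulrA -exprMn.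
  rewrite mulrAC -natrM -natrX mulrC ler_wpM2l //.
  by apply: ler_wiXn2l; rewrite ?divr_ge0 ?(ltW q_gt0) //; lia.
rewrite sumr_const -[leLHS]mulr_natr expr_div_n mulrA mulrAC.
have qa_gt0 : 0 < q%:R ^+ a :> K by rewrite exprn_gt0.
rewrite ler_pdivrMr //.
have : (32 * 4 ^ a * #|[set W in CC | v \in W]|)%:R <= (q ^ a)%:R :> K.
  by rewrite ler_nat; apply: leq_trans le_q; rewrite leq_mul.
by rewrite !natrM !natrX; lra.
Qed.

(** The obstacles are the edges and the pairs of a large cluster [W] and a
    subset [A], which is violated when [A] and [W :\: A] are monochromatic. *)
Lemma exists_family_coloring (FF : hfamily) (H : hypergraph) r d m a t q :
  (1 < r)%N -> (0 < d)%N -> (1 < m)%N -> (r < a)%N -> t = minn m (a - 1) ->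
  (a <= (m * r.-1).+1)%N ->
  (forall F, FF F -> is_connected F) ->
  (forall F, FF F -> #|edges F| <= m)%N ->
  (forall F, FF F -> a <= #|vertex F|)%N ->
  r_uniform r H -> (max_degree H <= d)%N ->
  (2 ^ (3 * a - 2) * m ^ t * (r * d) ^ m <= q ^ (a - 2))%N ->
  exists c : H -> 'I_q, family_coloring FF c.
Proof.
move=> r_gt1 d_gt0 m_gt1 lt_ra tE le_a conF le_m ge_a unifH degH le_q.
have a_gt2 : (2 < a)%N by apply: leq_ltn_trans lt_ra.
have letm : (t <= m)%N by rewrite tE geq_minl.
have [q_ge8 q_edge q_clus] :=
  expn_bounds r_gt1 d_gt0 m_gt1 a_gt2 le_a letm le_q.
have unif e : e \in edges H -> #|e| = r.-1.+1.
  by move=> eH; rewrite prednK ?unifH // ltnW.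
have deg (x : H) : (#|[set e in edges H | x \in e]| <= d)%N.
  by apply: leq_trans degH; apply: (leq_bigmax (F := @degree H)).
pose CC : {set {set H}} := [set W : {set H} | (a <= #|W|)%N &
  [forall x in W, W \in clusters (edges H) t x]].
pose P (i : {set H} + {set H} * {set H}) := match i with
  | inl e => e \in edges H | inr p => (p.1 \in CC) && (p.2 \subset p.1) end.
pose D (i : {set H} + {set H} * {set H}) := match i with
  | inl e => e | inr p => p.1 end.
pose R (i : {set H} + {set H} * {set H}) := match i with
  | inl e => all_but_one e
  | inr p => all_but_one p.2 :|: all_but_one (p.1 :\: p.2) end.
pose B (i : {set H} + {set H} * {set H}) (c : {ffun H -> 'I_q}) :=
  match i with
  | inl e => monob c e | inr p => monob c p.2 && monob c (p.1 :\: p.2) end.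
have [||||| c cP] := @exists_avoiding rat H 'I_q _ D R B P.
- case=> [e|[W A]] /= Pi; rewrite -card_gt0; first by rewrite unif.
  move: Pi; rewrite inE => /andP[/andP[+ _] _]; apply: leq_trans.
  exact: ltn_trans a_gt2.
- case=> [e|[W A]] c c' /= Pi cc; first exact: monob_local.
  have /andP[_ /subsetP AW] := Pi.
  case/andP=> cA cWA; apply/andP; split.
    by apply: monob_local cA => x /AW/cc.
  by apply: monob_local cWA => x /setDP[/cc].
- case=> [e|[W A]] c c' /= Pi.
    move=> ce c'e cc; apply/ffunP => x.
    have [xe|xNe] := boolP (x \in e); last first.
      apply: cc; rewrite inE.
      by apply: contra xNe; apply/subsetP/all_but_one_sub.
    apply: (monob_determined ce c'e) xe => z /setDP[_ zR].
    by apply: cc; rewrite inE.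
  case/andP=> cA cWA /andP[c'A c'WA] cc; apply/ffunP => x.
  have [xA|xNA] := boolP (x \in A).
    apply: (monob_determined cA c'A) xA => z /setDP[zA zR].
    apply: cc; rewrite !inE (negPf zR) /=.
    apply: contraL zA => /(subsetP (all_but_one_sub _)).
    by rewrite inE => /andP[].
  have [xW|xNW] := boolP (x \in W); last first.
    apply: cc; rewrite !inE negb_or; apply/andP; split.
      by apply: contra xNA; apply/subsetP/all_but_one_sub.
    by apply: contra xNW => /(subsetP (all_but_one_sub _))/setDP[].
  apply: (monob_determined cWA c'WA); last by rewrite inE xNA.
  move=> z /setDP[/setDP[zW zA] zR]; apply: cc; rewrite !inE (negPf zR) orbF.
  by apply: contra zA; apply/subsetP/all_but_one_sub.
- move=> v; rewrite card_ord big_sumType /=.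
  have q_gt0 : (0 < q)%N by apply: leq_trans q_ge8.
  have edges_le : (8 * 2 ^ r.-1 * d <= q ^ r.-1)%N.
    apply: leq_trans q_edge; rewrite mulnA leq_mul //.
    rewrite -[in leqRHS](prednK (ltnW r_gt1)) -[8%N]/(2 * 4)%N expnMn.
    have : (4 <= 4 ^ r.-1)%N by rewrite -{1}(expn1 4) leq_pexp2l //; lia.
    by move: (2 ^ _)%N (4 ^ _)%N => x y; nia.
  have CC_ge W : W \in CC -> ((a - 2).+2 <= #|W|)%N.
    by rewrite inE => /andP[+ _]; lia.
  have CC_deg : (#|[set W in CC | v \in W]| <= (m * (r * d)) ^ t)%N.
    rewrite -[in leqRHS](prednK (ltnW r_gt1)).
    apply: leq_trans (card_clusters v unif deg letm).
    apply/subset_leq_card/subsetP => W; rewrite !inE => /andP[/andP[_ Wt] vW].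
    exact: (forall_inP Wt).
  have clusters_le :
      (32 * 4 ^ (a - 2) * (m * (r * d)) ^ t <= q ^ (a - 2))%N.
    apply: leq_trans q_clus; rewrite leq_mul //.
    rewrite -[32%N]/(2 ^ 5)%N -[4%N]/(2 ^ 2)%N -expnM -expnD.
    by rewrite leq_pexp2l //; lia.
  have := edge_weight rat unif (deg v) q_gt0 edges_le.
  have := cluster_weight rat CC_ge CC_deg (leq_trans _ q_ge8) clusters_le.
  by move=> /(_ isT); lra.
- by rewrite card_ord (leq_trans _ q_ge8).
exists c; split=> [e eH mono|F W Z FFF [ZE ZW] [f [f_inj fT fE]] bic].
  by have /negP[] := cP (inl e) eH; apply/monobP.
have F_gt1 : (1 < #|vertex F|)%N by apply: leq_trans (ge_a F FFF); apply: ltnW.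
have [x _] : exists x : F, x \in F by apply/card_gt0P/ltnW.
(* U is grown inside F; its image in H is a cluster, as f preserves edges. *)
have [U Ut Ubig] := exists_spread_cluster t x (conF F FFF) F_gt1.
have U_ge : (a <= #|U|)%N.
  case: Ubig => [->|[tU tE']]; first by rewrite cardsT ge_a.
  by have := le_m F FFF; move: tU tE'; rewrite tE; lia.
have fUt : f @: U \in clusters (edges H) t (f x).
  apply: clusters_imset Ut => // e eF; apply: (subsetP ZE).
  by rewrite -fE imset_f.
have fUW : f @: U \subset W by rewrite -fT imsetS ?subsetT.
have /cards2P[c1 [c2 [_ cW]]] : #|c @: W| == 2 by apply/eqP.
pose A := [set y in f @: U | c y == c1].
have PA : P (inr (f @: U, A)).
  rewrite /= inE card_imset // U_ge /=; apply/andP; split; last first.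
    by apply/subsetP => y; rewrite inE => /andP[].
  by apply/forall_inP => y; apply: cluster_reroot fUt.
have col y : y \in f @: U -> c y != c1 -> c y = c2.
  move=> yU; have : c y \in c @: W by rewrite imset_f // (subsetP fUW).
  by rewrite cW !inE => /orP[->|/eqP].
have /negP[] := cP _ PA; apply/andP; split; apply/monobP => y z.
  by rewrite !inE => /andP[_ /eqP->] /andP[_ /eqP->].
rewrite !in_setD !inE => /andP[+ yU] /andP[+ zU]; rewrite yU zU /=.
by move=> /(col _ yU)-> /(col _ zU)->.
Qed.

(** * The extremal chromatic number *)

(** A sunflower: [d] petals, each a single vertex joined to a common kernel of
    [r - 1] vertices. *)
Lemma exists_uniform_hypergraph r d : (1 < r)%N ->
  exists H, r_uniform r H /\ max_degree H = d.
Proof.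
move=> r_gt1; pose V : finType := ('I_d + 'I_r.-1)%type.
pose petal (i : 'I_d) : {set V} := inl i |: inr @: [set: 'I_r.-1].
have petal_inj : injective petal.
  move=> i j /setP/(_ (inl i)); rewrite !inE eqxx /=.
  by case/esym/orP => [/eqP[]//|/imsetP[]].
pose H := Hypergraph [set petal i | i : 'I_d].
have edgesE : #|edges H| = d by rewrite card_imset // card_ord.
exists H; split.
  move=> _ /imsetP[i _ ->].
  have iN : inl i \notin (inr @: [set: 'I_r.-1] : {set V}).
    by apply/imsetP => -[].
  have inr_inj : injective (inr : 'I_r.-1 -> V) by move=> ? ? [].
  rewrite /petal cardsU1 iN (card_imset _ inr_inj) cardsT card_ord add1n.
  exact/prednK/ltnW.
apply/eqP; rewrite eqn_leq; apply/andP; split.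
  apply/bigmax_leqP => x _; rewrite -edgesE.
  by apply/subset_leq_card/subsetP => e; rewrite inE => /andP[].
have r1_gt0 : (0 < r.-1)%N by lia.
pose x : H := inr (Ordinal r1_gt0).
apply: leq_trans (leq_bigmax x); rewrite -{1}edgesE.
apply/subset_leq_card/subsetP => e eH; rewrite inE eH /=.
by case/imsetP: eH => i _ ->; rewrite !inE /= imset_f.
Qed.

From mathcomp Require Import all_classical all_reals all_analysis.

Lemma exists_is_min (P : nat -> Prop) n :
  P n -> exists2 k, is_min P k & (k <= n)%N.
Proof.
move=> Pn; have exP : exists k, `[< P k >] by exists n; apply/asboolP.
case: (ex_minnP exP) => k /asboolP Pk min_k.
by exists k; [split=> // j Pj|]; apply/min_k/asboolP.
Qed.

Lemma exists_is_max (P : nat -> Prop) n b :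
  P n -> (forall k, P k -> (k <= b)%N) -> exists k, is_max P k.
Proof.
move=> Pn Pb; have exP : exists k, `[< P k >] by exists n; apply/asboolP.
have Pb' k : `[< P k >] -> (k <= b)%N by move/asboolP/Pb.
case: (ex_maxnP exP Pb') => k /asboolP Pk max_k.
by exists k; split=> // j Pj; apply/max_k/asboolP.
Qed.

(** A uniform bound on the number of colours makes the chromatic numbers exist
    and be bounded; the maximum exists since some hypergraph has degree [d]. *)
Lemma exists_is_chi_max (FF : hfamily) r d q : (1 < r)%N ->
  (forall H, r_uniform r H -> max_degree H = d ->
     exists c : H -> 'I_q, family_coloring FF c) ->
  exists2 k, is_chi_max FF r d k & (k <= q)%N.
Proof.
move=> r_gt1 col.
pose chi k := exists H, [/\ r_uniform r H, max_degree H = d & is_chi FF H k].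
have hasChi H : r_uniform r H -> max_degree H = d ->
  exists2 j, is_chi FF H j & (j <= q)%N.
  by move=> unif deg; apply: exists_is_min; apply: col.
have chi_le k : chi k -> (k <= q)%N.
  by case=> H [unif deg [_]]; apply; apply: col.
have [H [unif deg]] := exists_uniform_hypergraph d r_gt1.
have [j jchi _] := hasChi H unif deg.
have [|k [kchi kmax]] := exists_is_max (P := chi) (n := j) _ chi_le.
  by exists H.
exists k; last exact: chi_le.
split=> // G unifG degG; have [i ichi _] := hasChi G unifG degG.
by exists i => //; apply: kmax; exists G.
Qed.

Lemma le_ceil_root (R : realType) (n X : nat) : (0 < n)%N ->
  exists2 q : nat, (X <= q ^ n)%N &
    q%:Z = Num.ceil ((X%:R : R) `^ (1 / n%:R)).
Proof.
move=> n_gt0; set y := _ `^ _.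
have y_ge0 : 0 <= y by apply: powR_ge0.
have yn : y ^+ n = X%:R.
  rewrite -powR_mulrn // -powRrM div1r mulVf ?powRr1 ?ler0n //.
  by rewrite pnatr_eq0 -lt0n.
have ceil_y : `|Num.ceil y|%N%:Z = Num.ceil y.
  by rewrite gez0_abs // ceil_ge0 // (lt_le_trans _ y_ge0) // oppr_lt0.
exists `|Num.ceil y|%N => //.
rewrite -(ler_nat R) natrX -yn lerXn2r ?nnegrE //.
by rewrite -[_%:R]/(_%:Z%:~R) ceil_y ceil_ge.
Qed.

Theorem theorem1 (R : realType) (r d m a t : nat) (FF : hfamily)
  (hr : (2 <= r)%N) (hd : (1 <= d)%N)
  (FF_nonempty : exists F, FF F)
  (FF_uniform : forall F, FF F -> r_uniform r F)
  (FF_connected : forall F, FF F -> is_connected F)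
  (hm : is_max (fun k => exists2 F, FF F & #|edges F| = k) m)
  (m_ge2 : (2 <= m)%N)
  (ha : is_min (fun k => exists2 F, FF F & #|vertex F| = k) a)
  (a_gt : (r + 1 <= a)%N)
  (ht : t = minn m (a - 1)) :
  exists2 k : nat, is_chi_max FF r d k &
    k%:Z <= Num.ceil
      ((2 ^+ (3 * a - 2)%N * m%:R ^+ t * (r%:R * d%:R) ^+ m : R)
         `^ (1 / (a%:R - 2))).
Proof.
have lt_ra : (r < a)%N by rewrite -addn1.
have a_gt2 : (2 < a)%N by apply: leq_ltn_trans lt_ra.
have [_ le_m] := hm; have [[F FFF Fa] ge_a] := ha.
have Fm : (#|edges F| <= m)%N by apply: le_m; exists F.
have le_a : (a <= (m * r.-1).+1)%N.
  have F_gt1 : (1 < #|vertex F|)%N by rewrite Fa ltnW.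
  have /card_gt0P[x _] := ltnW F_gt1.
  have [W Wm WT] := exists_spread_cluster m x (FF_connected F FFF) F_gt1.
  (* m steps exhaust F, which has at most m edges. *)
  have -> : a = #|W| by case: WT => [->|[_]]; rewrite ?cardsT // ltnNge Fm.
  apply: card_cluster Wm => e eF.
  by rewrite (FF_uniform F FFF) // prednK // ltnW.
have FF_edges G : FF G -> (#|edges G| <= m)%N.
  by move=> FFG; apply: le_m; exists G.
have FF_vertices G : FF G -> (a <= #|vertex G|)%N.
  by move=> FFG; apply: ge_a; exists G.
have a2_gt0 : (0 < a - 2)%N by rewrite subn_gt0.
have [q le_q qE] :=
  le_ceil_root R (2 ^ (3 * a - 2) * m ^ t * (r * d) ^ m) a2_gt0.
have [k kchi le_kq] : exists2 k, is_chi_max FF r d k & (k <= q)%N.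
  apply: exists_is_chi_max => // H unifH degH.
  apply: exists_family_coloring le_q; eauto.
  by rewrite degH.
exists k; first exact: kchi.
have aE : a%:R - 2 = (a - 2)%:R :> R by rewrite natrB // ltnW.
have XE : 2 ^+ (3 * a - 2)%N * m%:R ^+ t * (r%:R * d%:R) ^+ m =
    (2 ^ (3 * a - 2) * m ^ t * (r * d) ^ m)%:R :> R.
  by rewrite 2!natrM 3!natrX natrM.
by rewrite aE XE -qE lez_nat.
Qed.
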